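(* Let $H$ be a complex Hilbert space (or, more generally, a complex Banach space), and let $A$ be a closable densely defined linear operator with domain $D(A)\subset H$ such that $\sigma(A^2)\neq\mathbb{C}$. Then $A$ is closed.
   Context: Operators are linear and not necessarily bounded, with a domain $D(A)$ a linear subspace of $H$. $A^2$ is defined on its natural domain $D(A^2)=\{x\in D(A): Ax\in D(A)\}$. $A$ is closed if its graph is closed, and closable if it has a closed extension. For any (not necessarily closed) operator $S$, the resolvent set $\rho(S)$ is the set of $\lambda\in\mathbb{C}$ such that $\lambda I-S:D(S)\to H$ is bijective with $(\lambda I-S)^{-1}\in B(H)$ (bounded and everywhere defined); $\sigma(S)=\mathbb{C}\setminus\rho(S)$. In particular $\sigma(S)=\mathbb{C}$ if $S$ is not closed. *)

(* Defs.v *)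
From HB Require Import structures.
From mathcomp Require Import all_boot all_order all_algebra.
From mathcomp Require Import all_classical all_reals all_analysis.
From mathcomp Require Export complex.
Import Order.TTheory GRing.Theory Num.Theory.
Import numFieldNormedType.Exports.

Set Implicit Arguments.
Unset Strict Implicit.
Unset Printing Implicit Defensive.

Local Open Scope classical_set_scope.
Local Open Scope ring_scope.

(* A not necessarily bounded operator is stored as a total function whose
   values outside [dom] are irrelevant: everything below depends on it only
   through its graph over [dom]. *)
Record operator (K : numFieldType) (V : normedModType K) := Operator {
  dom : set V ;
  op_fun :> V -> V ;
  dom0 : dom 0 ;
  domP : forall (a : K) (x y : V), dom x -> dom y -> dom (a *: x + y) ;
  op_linearP : forall (a : K) (x y : V), dom x -> dom y ->
    op_fun (a *: x + y) = a *: op_fun x + op_fun y }.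

Section Operators.
Context {K : numFieldType} {V : normedModType K}.
Implicit Types A B S : operator V.

Definition op_graph A : set (V * V) := [set p | dom A p.1 /\ p.2 = A p.1].

Definition op_extends A B : Prop :=
  dom A `<=` dom B /\ forall x, dom A x -> B x = A x.

Definition closed_op A : Prop := closed (op_graph A).

Definition closable_op A : Prop := exists B, op_extends A B /\ closed_op B.

Definition densely_defined A : Prop := dense (dom A).

Definition sqr_dom A : set V := [set x | dom A x /\ dom A (A x)].

Fact sqr_dom0 A : sqr_dom A 0.
Proof.
have A0 : A 0 = 0.
  have := op_linearP (-1) (dom0 A) (dom0 A).
  by rewrite scaler0 addr0 scaleN1r addNr.
by split; [exact: dom0 | rewrite A0; exact: dom0].
Qed.

Fact sqr_domP A (a : K) (x y : V) :
  sqr_dom A x -> sqr_dom A y -> sqr_dom A (a *: x + y).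
Proof.
move=> [dx dAx] [dy dAy]; split; first exact: domP.
by rewrite op_linearP //; exact: domP.
Qed.

Fact sqr_linearP A (a : K) (x y : V) : sqr_dom A x -> sqr_dom A y ->
  A (A (a *: x + y)) = a *: A (A x) + A (A y).
Proof. by move=> [dx dAx] [dy dAy]; rewrite !op_linearP. Qed.

Definition op_sqr A : operator V :=
  Operator (@sqr_dom0 A) (@sqr_domP A) (@sqr_linearP A).

(* [bounded_near T (nbhs 0)] is boundedness of a linear map, cf. the library
   lemma [linear_boundedP]. *)
Definition resolvent_set S : set K := [set l |
  set_bij (dom S) setT (fun x => l *: x - S x) /\
  exists T : {linear V -> V},
    (forall x, dom S x -> T (l *: x - S x) = x) /\
    bounded_near T (nbhs (0 : V))].

Definition spectrum S : set K := ~` resolvent_set S.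

End Operators.

(* Main.v *)
(** If [l = m^2] lies in the resolvent set of [A^2], the factorization
    [m^2 - A^2 = (m - A)(m + A) = (m + A)(m - A)] on [D(A^2)] shows that
    [m - A] is a bijection of [D(A)] onto the space with inverse [(m + A) T],
    where [T] is the bounded inverse of [m^2 - A^2].  If [B] is a closed
    extension of [A], this inverse equals [(m + B) T], whose graph is closed
    because [B] is closed and [T] continuous; hence [m - A], and so [A], has
    closed graph. *)
Require Import Defs.
From mathcomp Require Import all_boot all_order all_algebra.
From mathcomp Require Import all_classical all_reals all_analysis.
Import GRing.Theory Num.Theory numFieldNormedType.Exports.

Local Open Scope classical_set_scope.
Local Open Scope ring_scope.

Lemma sqr_dom_addZ (K : numFieldType) (V : normedModType K) (A : operator V)
    (m : K) (x : V) : sqr_dom A x ->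
  dom A (m *: x + A x) /\ A (m *: x + A x) = m *: A x + A (A x).
Proof. by move=> [dx dAx]; split; [exact: domP | exact: op_linearP]. Qed.

Lemma op_fun0 (K : numFieldType) (V : normedModType K) (A : operator V) :
  A 0 = 0.
Proof.
have := op_linearP (-1) (dom0 A) (dom0 A).
by rewrite scaler0 addr0 scaleN1r addNr.
Qed.

Lemma domZ (K : numFieldType) (V : normedModType K) (A : operator V)
    (m : K) (x : V) : dom A x -> dom A (m *: x).
Proof. by move=> dx; rewrite -[_ *: _]addr0; exact: domP dx (dom0 A). Qed.

Lemma op_funZ (K : numFieldType) (V : normedModType K) (A : operator V)
    (m : K) (x : V) : dom A x -> A (m *: x) = m *: A x.
Proof.
move=> dx; rewrite -[_ *: x]addr0 op_linearP //; last exact: dom0.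
by rewrite op_fun0 addr0.
Qed.

(** The difference [u] of [x] and [y] satisfies [A u = m *: u], which puts [A u] back in [dom A]. So
    [u] lies in the domain of the square and is killed by [m ^+ 2 - A ^ 2], which is injective. *)
Lemma sqr_resolvent_sub_inj (K : numFieldType) (V : normedModType K)
    (A : operator V) (m : K) (x y : V) : resolvent_set (op_sqr A) (m ^+ 2) ->
  dom A x -> dom A y -> m *: x - A x = m *: y - A y -> x = y.
Proof.
move=> [[_ injS _] _] dx dy exy.
set u := (-1) *: y + x.
have du : dom A u by exact: domP.
have Au : A u = m *: u.
  apply/esym/eqP; rewrite -subr_eq0 op_linearP // scalerDr !scaleN1r scalerN.
  by rewrite opprD opprK addrACA exy addrACA addNr subrr addr0.
have d2u : sqr_dom A u by split=> //; rewrite Au; exact: domZ.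
have u0 : u = 0.
  apply: injS; rewrite ?in_setE //=; first exact: sqr_dom0.
  by rewrite !op_fun0 scaler0 subr0 Au op_funZ // Au scalerA -expr2 subrr.
by move/eqP: u0; rewrite /u scaleN1r addrC subr_eq0 => /eqP.
Qed.

Lemma closed_op_of_sqr_resolvent (K : numFieldType) (V : normedModType K)
    (A : operator V) (m : K) : closable_op A ->
  resolvent_set (op_sqr A) (m ^+ 2) -> closed_op A.
Proof.
move=> [B [[domAB AB] closedB]] resA.
have [[_ _ surjS] [T [TS Tbnd]]] := resA.
have Tcont : continuous T by exact: bounded_linear_continuous.
(* [TS] makes [T] a left inverse only; surjectivity makes it a right inverse with values in
   [sqr_dom A]. *)
have TP z : sqr_dom A (T z) /\ m ^+ 2 *: T z - A (A (T z)) = z.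
  have [w dw Sw] := surjS z I.
  by rewrite -Sw TS.
pose z (p : V * V) := m *: p.1 - p.2.
(* [F (x, y)] lies in the graph of [B] exactly when [x = (m + B) (T (m *: x - y))]; [B] agrees with
   [A] on the range of [T]. *)
pose F (p : V * V) := (T (z p), p.1 - m *: T (z p)).
have graphE : op_graph A = F @^-1` op_graph B.
  apply/seteqP; split=> -[x y] /=; rewrite /op_graph /F /z /=.
    move=> [dx ->].
    have [d2w Sw] := TP (m *: x - A x).
    set w := T _ in d2w Sw *.
    have [dv Av] := @sqr_dom_addZ _ _ A m w d2w.
    have [dw dAw] := d2w.
    split; first exact: domAB.
    (* Both [m *: w + A w] and [x] are sent by [m - A] to [m *: x - A x], so they coincide. *)
    rewrite AB // -(@sqr_resolvent_sub_inj _ _ A m _ x resA dv dx).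
      by rewrite addrC addKr.
    by rewrite Av scalerDr scalerA -expr2 -[RHS]Sw addrKA.
  have [d2w Sw] := TP (m *: x - y).
  set w := T _ in d2w Sw *.
  have [dv Av] := @sqr_dom_addZ _ _ A m w d2w.
  (* Membership now reads [x = m *: w + A w], so [x] is in [dom A]; applying [m - A] gives
     [m *: x - y], whence [y = A x]. *)
  move=> [_]; rewrite AB; last by case: d2w.
  move=> /eqP; rewrite subr_eq addrC => /eqP xE.
  have -> : y = m *: x - (m ^+ 2 *: w - A (A w)).
    by rewrite Sw opprB addrC subrK.
  rewrite xE; split=> //.
  by rewrite Av scalerDr scalerA -expr2 opprB addrC addrA subrK addrC.
rewrite /closed_op graphE; apply: preimage_closed closedB => p _.
have zcont : z q @[q --> p] --> z p.
  by apply: cvgB; [apply: cvgZl_tmp; exact: cvg_fst | exact: cvg_snd].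
have Tz : T (z q) @[q --> p] --> T (z p).
  by apply: cvg_comp zcont _; exact: Tcont.
by apply: cvg_pair => //; apply: cvgB; [exact: cvg_fst | exact: cvgZl_tmp].
Qed.

Theorem theorem2p1 (R : realType) (H : completeNormedModType R[i])
    (A : operator H) (hdense : densely_defined A) (hclosable : closable_op A)
    (hsigma : spectrum (op_sqr A) <> [set: R[i]]) :
  closed_op A.
Proof.
have [l resl] : exists l, resolvent_set (op_sqr A) l.
  apply: contrapT => /forallNP nres; apply: hsigma.
  by apply/seteqP; split=> // l _; exact: nres.
(* Over the complex numbers every [l] is a square. *)
apply: (@closed_op_of_sqr_resolvent _ _ _ (sqrtC l)) => //.
by rewrite sqrtCK.
Qed.
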